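(* For every instance $\pi$ of the fully labeled one-dimensional rearrangement problem (LOR), the algorithm OptPlanLOR computes a valid rearrangement plan that has minimum end-effector travel among all valid plans for $\pi$ that use the minimum possible number of pick-n-swaps.
   Context: Setting (LOR). A row of $m$ cells $1,\dots,m$, cell $i$ located at the point $i$ on the real line. Each cell initially holds exactly one item; items carry distinct labels $1,\dots,m$. An instance is a permutation $\pi$ of $\{1,\dots,m\}$, where $\pi_i$ is the label of the item initially in cell $i$; the goal is that item $i$ ends in cell $i$. A robot end-effector can hold at most one item; it starts at cell $1$ holding nothing. A pick-n-swap operation at a cell $p$: if holding nothing, pick up the item in $p$; if holding an item and $p$ contains an item, exchange the two; if holding an item and $p$ is empty, put the held item into $p$. A plan is a sequence $P=(p_0,p_1,\dots,p_N)$ of cells ($p_0=$ cell $1$) visited in order with a pick-n-swap at each of $p_1,\dots,p_N$, followed by a return to $p_{N+1}:=p_0$; it is valid if at the end every item $i$ is in cell $i$ and the end-effector holds nothing. $N$ is its number of pick-n-swaps and $\sum_{i=0}^N|p_i-p_{i+1}|$ its end-effector travel. Cycles: the non-trivial cycles (length $\ge 2$) of $\pi$, where cell $i$ points to cell $\pi_i$ (the goal of the item in cell $i$). For a cycle $c$ let $\min(c),\max(c)$ be its smallest and largest cell; for a set $C$ of cycles, $\min(C)=\min_{c\in C}\min(c)$, $\max(C)=\max_{c\in C}\max(c)$. Cycle groups: start with each cycle as a singleton group and repeatedly replace two groups whose intervals $[\min,\max]$ intersect by their union, until the groups' intervals are pairwise disjoint. OptPlanLOR: process the leftmost group. Within a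 group $C=\{c_1,c_2,\dots\}$ with $\min(c_1)<\min(c_2)<\dots$, start following cycle $c_1$ from cell $\min(c_1)$ by cycle following (pick the item at the starting cell, repeatedly carry the held item to its goal cell and swap, and close the cycle by placing the last item in the starting cell). When, while following a cycle, the end-effector carrying an item would pass over $\min(c')$ for the next not-yet-started cycle $c'$ of the group, it switches: at cell $\min(c')$ it swaps the carried item into that cell (parking it) and follows $c'$ in the same manner (recursively applying the same switching rule); upon closing $c'$ at $\min(c')$ it picks the parked item back up and resumes the interrupted cycle. When the end-effector reaches $\max(C)$ and there is a group to the right of $C$, it pauses and processes the next group to the right in the same way (recursively), then returns to finish $C$. After all groups are processed the end-effector returns to cell $1$. *)

(* Defs.v *)
From mathcomp Require Import all_boot.
Set Implicit Arguments. Unset Strict Implicit. Unset Printing Implicit Defensive.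

(* Instances.  An instance of LOR with m cells is a sequence [pi] of size  *)
(* m that is a permutation of [1; ...; m]; cell i (1 <= i <= m) initially *)
(* holds the item labelled [pf pi i] = pi_i.                              *)

Definition pf (pi : seq nat) (i : nat) : nat := nth 0 pi i.-1.

Definition is_instance (pi : seq nat) : Prop := perm_eq pi (iota 1 (size pi)).

Record state := St { hold : option nat; cont : nat -> option nat }.

Definition upd (f : nat -> option nat) (p : nat) (v : option nat) :=
  fun q => if q == p then v else f q.

(* one pick-n-swap at cell p (picking at an empty cell with an empty
   end-effector is a no-op; such a case is not covered by the paper) *)
Definition pns (s : state) (p : nat) : state :=
  match hold s, cont s p with
  | None, Some y => St (Some y) (upd (cont s) p None)
  | None, None => s
  | Some x, Some y => St (Some y) (upd (cont s) p (Some x))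
  | Some x, None => St None (upd (cont s) p (Some x))
  end.

Definition init (pi : seq nat) : state :=
  St None (fun q => if (1 <= q <= size pi) then Some (pf pi q) else None).

(* A plan is the sequence (p_1, ..., p_N) of cells; p_0 = p_{N+1} = cell 1 *)
Definition run (pi : seq nat) (P : seq nat) : state := foldl pns (init pi) P.

Definition valid (pi : seq nat) (P : seq nat) : Prop :=
  all (fun p => 1 <= p <= size pi) P /\
  hold (run pi P) = None /\
  (forall i, 1 <= i <= size pi -> cont (run pi P) i = Some i).

Definition nswaps (P : seq nat) : nat := size P.

Definition dist (a b : nat) : nat := (a - b) + (b - a).

Definition travel (P : seq nat) : nat := sumn (pairmap dist 1 (rcons P 1)).

(* A non-trivial cycle is represented by its smallest cell.                *)

Definition orb (pi : seq nat) (i : nat) : seq nat := traject (pf pi) i (size pi).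
Definition cmin (pi : seq nat) (i : nat) : nat := foldr minn i (orb pi i).
Definition cmax (pi : seq nat) (i : nat) : nat := foldr maxn i (orb pi i).

Definition nontriv (pi : seq nat) (i : nat) : bool :=
  (1 <= i <= size pi) && (pf pi i != i).

Definition cyc_reps (pi : seq nat) : seq nat :=
  [seq i <- iota 1 (size pi) | nontriv pi i && (cmin pi i == i)].

(* a group is a list of cycle representatives *)
Definition gmin (pi : seq nat) (G : seq nat) : nat := foldr minn (head 0 G) G.
Definition gmax (pi : seq nat) (G : seq nat) : nat :=
  foldr maxn 0 [seq cmax pi c | c <- G].

Definition ginter (pi : seq nat) (G H : seq nat) : bool :=
  (gmin pi G <= gmax pi H) && (gmin pi H <= gmax pi G).

Fixpoint merge_into (pi : seq nat) (G : seq nat) (gs : seq (seq nat))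
  : option (seq (seq nat)) :=
  match gs with
  | [::] => None
  | H :: gs' => if ginter pi G H then Some ((G ++ H) :: gs')
                else omap (cons H) (merge_into pi G gs')
  end.

Fixpoint merge_step (pi : seq nat) (gs : seq (seq nat)) : option (seq (seq nat)) :=
  match gs with
  | [::] => None
  | G :: gs' => match merge_into pi G gs' with
                | Some r => Some r
                | None => omap (cons G) (merge_step pi gs')
                end
  end.

Fixpoint merge_iter (pi : seq nat) (n : nat) (gs : seq (seq nat)) : seq (seq nat) :=
  match n with
  | 0 => gs
  | n'.+1 => match merge_step pi gs with
             | Some gs' => merge_iter pi n' gs'
             | None => gs
             end
  end.

(* each merge decreases the number of groups, so |cycles| iterations suffice *)
Definition groups (pi : seq nat) : seq (seq nat) :=
  merge_iter pi (size (cyc_reps pi)) [seq [:: c] | c <- cyc_reps pi].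

Definition group_of (pi : seq nat) (i : nat) : seq nat :=
  nth [::] (groups pi) (find (fun G => gmin pi G <= i <= gmax pi G) (groups pi)).

Definition next_group (pi : seq nat) (G : seq nat) : option (seq nat) :=
  let R := [seq H <- groups pi | gmax pi G < gmin pi H] in
  if R is H0 :: _ then
    Some (nth [::] R (find (fun H => gmin pi H == foldr minn (gmin pi H0) [seq gmin pi K | K <- R]) R))
  else None.

Definition first_unstarted (G started : seq nat) : option nat :=
  ohead [seq c <- sort leq G | c \notin started].

Definition strictly_between (a c b : nat) : bool :=
  ((a < c) && (c < b)) || ((b < c) && (c < a)).

(* OptPlanLOR.  The end-effector always carries the held item towards its  *)
(* goal cell, except that (i) it switches to the next not-yet-started     *)
(* cycle of the current group whenever it would pass over that cycle's    *)
(* smallest cell, and (ii) right after its pick-n-swap at max(C) it goes  *)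
(* to the smallest cell of the next group to the right (if any).  Parked  *)
(* items are recovered automatically by pick-n-swap semantics.  With an   *)
(* empty end-effector it starts the leftmost not-yet-started cycle.       *)
(* [anext] returns the next pick-n-swap cell and the updated set of       *)
(* started cycles; [pos] is the cell of the last pick-n-swap.             *)

Definition anext (pi : seq nat) (pos : nat) (s : state) (started : seq nat)
  : option (nat * seq nat) :=
  match hold s with
  | None =>
      match first_unstarted (cyc_reps pi) started with
      | Some c => Some (c, c :: started)
      | None => None
      end
  | Some g =>
      let C := group_of pi pos in
      match (if nontriv pi pos && (pos == gmax pi C) then next_group pi C else None) with
      | Some H => Some (gmin pi H, gmin pi H :: started)
      | None =>
          match first_unstarted (group_of pi g) started with
          | Some c => if strictly_between pos c g then Some (c, c :: started)
                      else Some (g, started)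
          | None => Some (g, started)
          end
      end
  end.

Fixpoint arun (pi : seq nat) (fuel pos : nat) (s : state) (started : seq nat)
  : seq nat :=
  match fuel with
  | 0 => [::]
  | f.+1 => match anext pi pos s started with
            | None => [::]
            | Some (p, st') => p :: arun pi f p (pns s p) st'
            end
  end.

(* the plan computed by OptPlanLOR (the final return to cell 1 is implicit
   in [travel]); the fuel bound is far above the 3m/2 operations needed *)
Definition OptPlanLOR (pi : seq nat) : seq nat :=
  arun pi (4 * size pi + 1) 1 (init pi) [::].

(* Main.v *)
(* A pick-n-swap always exchanges the content of the end-effector with that of
   the cell. Number of swaps: a valid plan visits every misplaced cell, and the
   first visited cell of each cycle at least twice. Travel: each edge between
   adjacent cells is crossed rightwards at least as often as there are items
   whose path crosses it, and at least once if a cycle lies entirely to its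
   right; a closed tour crosses every edge equally often in both directions.
   OptPlanLOR meets both bounds. Its state is described by the route that the
   end-effector would follow by pure cycle following: starting a cycle prepends
   that cycle to the route, delivering an item removes its head. Cycles are
   started from left to right, each exactly once, and every move either carries
   an item towards its goal or crosses, once, a gap before a group. *)
Require Import Defs.
From mathcomp Require Import all_boot zify.
Set Implicit Arguments.
Unset Strict Implicit.
Unset Printing Implicit Defensive.

Lemma foldr_selects_mem (T : eqType) (op : T -> T -> T) x s :
  (forall y z, op y z \in [:: y; z]) -> foldr op x s \in x :: s.
Proof.
move=> op_sel; elim: s => [|y s IHs] /=; first exact: mem_head.
have := op_sel y (foldr op x s); rewrite !inE => /orP[]/eqP->.
  by rewrite eqxx orbT.
by move: IHs; rewrite inE => /orP[]->; rewrite ?orbT.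
Qed.

Lemma foldr_minn_mem x s : foldr minn x s \in x :: s.
Proof.
apply: foldr_selects_mem => y z; rewrite /minn.
by case: ifP; rewrite !inE eqxx ?orbT.
Qed.

Lemma foldr_maxn_mem x s : foldr maxn x s \in x :: s.
Proof.
apply: foldr_selects_mem => y z; rewrite /maxn.
by case: ifP; rewrite !inE eqxx ?orbT.
Qed.

Lemma leq_foldr_minn k x s : (k <= foldr minn x s) = all (leq k) (x :: s).
Proof.
by elim: s => [|y s IHs] /=; rewrite ?andbT // leq_min IHs /= andbCA.
Qed.

Lemma foldr_maxn_leq k x s : (foldr maxn x s <= k) = all (leq^~ k) (x :: s).
Proof.
by elim: s => [|y s IHs] /=; rewrite ?andbT // geq_max IHs /= andbCA.
Qed.

Lemma ohead_neq (T : eqType) (x : T) s : x \notin s -> ohead s != Some x.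
Proof.
case: s => //= y s; rewrite inE negb_or eq_sym (inj_eq Some_inj).
by case/andP.
Qed.

(** * Cycles of an injective map *)

Lemma fpath_map (T : eqType) (f : T -> T) x y p :
  fpath f x (rcons p y) -> map f (x :: p) = rcons p y.
Proof. by elim: p x => [|z p IHp] x /= /andP[/eqP-> //] /IHp <-. Qed.

Lemma mem_fcycle (T : eqType) (f : T -> T) p x :
  fcycle f p -> x \in p -> f x \in p.
Proof. by move=> fp xp; rewrite (eqP (next_cycle fp xp)) mem_next. Qed.

Lemma traject_ufcycle (T : eqType) (f : T -> T) p x n :
  ufcycle f p -> x \in p -> size p <= n -> traject f x n =i p.
Proof.
move=> /andP[fp _] xp pn y; apply/idP/idP => [/trajectP[i _ ->]|].
  by elim: i => //= i; apply: mem_fcycle.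
have [i q rot_p] := rot_to xp; rewrite -(mem_rot i) rot_p.
have q_traject : x :: q = traject f x (size p).
  move: fp; rewrite -(rot_cycle i) -(size_rot i) rot_p /= rcons_path.
  by case/andP => /fpathE q_def _; rewrite {1}q_def.
rewrite q_traject => /trajectP[j jp ->]; apply/trajectP.
by exists j => //; apply: leq_trans jp pn.
Qed.

Lemma ufcycle_from (T : choiceType) (f : T -> T) (D : seq T) x :
    {homo f : y / y \in D} -> {in D &, injective f} -> x \in D ->
  exists2 p, ufcycle f (x :: p) & {subset x :: p <= D}.
Proof.
move=> fD f_inj xD; pose g (y : seq_sub D) := SeqSub (fD _ (valP y)).
have g_inj : injective g.
  by move=> y z [/f_inj yz]; apply/val_inj/yz; apply: valP.
pose orbit_x := map val (orbit g (SeqSub xD)).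
have orbit_xE : orbit_x = x :: behead orbit_x.
  by rewrite /orbit_x /orbit -orderSpred.
exists (behead orbit_x); rewrite -orbit_xE.
  rewrite /ucycle map_inj_uniq ?orbit_uniq ?andbT; last exact: val_inj.
  by apply: homo_cycle (cycle_orbit g_inj _) => y z /= /eqP <-.
by move=> y /mapP[z _ ->]; apply: valP.
Qed.

(** * Pick-n-swaps and edge crossings *)

Lemma hold_pns s p : hold (pns s p) = cont s p.
Proof. by rewrite /pns; case: s => [[x|] f] /=; case: (f p). Qed.

Lemma cont_pns s p q : cont (pns s p) q = if q == p then hold s else cont s q.
Proof.
rewrite /pns; case: s => [[x|] f] /=; case fp: (f p) => [y|] //=.
by case: eqP => [->|].
Qed.

Lemma cont_foldl_pns P s q : q \notin P -> cont (foldl pns s P) q = cont s q.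
Proof.
elim: P s => //= p P IHP s; rewrite inE negb_or => /andP[qp qP].
by rewrite IHP // cont_pns (negPf qp).
Qed.

Lemma hold_foldl_pns_neq P s x p :
    p \notin P -> hold s <> Some x -> (forall q, cont s q = Some x -> q = p) ->
  hold (foldl pns s P) <> Some x.
Proof.
elim: P s => //= y P IHP s.
rewrite inE negb_or => /andP[/eqP py pP] hold_x only_p.
apply: IHP => //; first by rewrite hold_pns => /only_p /esym.
by move=> q; rewrite cont_pns; case: eqP => // _ /only_p.
Qed.

Local Notation within N := (all (fun p => 1 <= p <= N)).

(* Edge [k] joins the cells [k] and [k.+1]. *)
Definition rcross k a P :=
  sumn (pairmap (fun x y => nat_of_bool (x <= k < y)) a P).

Definition lcross k a P :=
  sumn (pairmap (fun x y => nat_of_bool (y <= k < x)) a P).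

Lemma rcross_cons k a p P : rcross k a (p :: P) = (a <= k < p) + rcross k p P.
Proof. by []. Qed.

Lemma rcross_rcons k a P x :
  rcross k a (rcons P x) = rcross k a P + (last a P <= k < x).
Proof.
elim: P a => [|p P IHP] a /=; first by rewrite /rcross /= addnC.
by rewrite !rcross_cons IHP addnA.
Qed.

Lemma rcross_lcross k a P :
  rcross k a P + (last a P <= k) = lcross k a P + (a <= k).
Proof.
elim: P a => //= p P IHP a; have := IHP p; rewrite /rcross /lcross /=; lia.
Qed.

Lemma rcross_gt0 k a p P : a <= k -> p \in P -> k < p -> 0 < rcross k a P.
Proof.
elim: P a => //= x P IHP a ak; rewrite inE rcross_cons => /orP[/eqP-> kx|pP kp].
  by rewrite ak kx.
case: (leqP x k) => xk; last by rewrite ak.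
by rewrite (leq_trans (IHP x xk pP kp)) // leq_addl.
Qed.

Lemma sum_between N a b : 0 < a -> b <= N ->
  \sum_(1 <= k < N) (a <= k < b) = b - a.
Proof.
move=> a_gt0 bN; have -> : b - a = minn N b - a by lia.
elim: N {bN} => [|[|N] IHN]; [by rewrite big_geq //; lia..|].
by rewrite big_nat_recr //= IHN; lia.
Qed.

Lemma sumn_dist N a P : within N (a :: P) ->
  sumn (pairmap dist a P) = \sum_(1 <= k < N) (rcross k a P + lcross k a P).
Proof.
elim: P a => [|p P IHP] a /=; first by rewrite big1.
move=> /and3P[aN pN PN]; rewrite (IHP p) /= ?pN //.
have -> : dist a p = \sum_(1 <= k < N) ((a <= k < p) + (p <= k < a)).
  by rewrite big_split /= !sum_between //; rewrite /dist; lia.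
rewrite -big_split /=; apply: eq_bigr => k _; rewrite /rcross /lcross /=; lia.
Qed.

Lemma travel_rcross N P : within N P ->
  travel P = \sum_(1 <= k < N.+1) 2 * rcross k 1 P.
Proof.
move=> PN; rewrite /travel (@sumn_dist N.+1); last first.
  rewrite /= all_rcons /=; apply: sub_all PN => p; lia.
apply: eq_big_nat => k /andP[k_gt0 _].
have := rcross_lcross k 1 (rcons P 1); rewrite last_rcons rcross_rcons; lia.
Qed.

Lemma leq_travel N P Q :
    within N P -> within N Q ->
    (forall k, 0 < k -> rcross k 1 P <= rcross k 1 Q) ->
  travel P <= travel Q.
Proof.
move=> PN QN le_PQ; rewrite !(@travel_rcross N) // big_nat [X in _ <= X]big_nat.
by apply: leq_sum => k /andP[k_gt0 _]; rewrite leq_mul2l le_PQ.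
Qed.

Definition goal_beyond k (o : option nat) :=
  if o is Some g then k < g else false.

(* [a] is the position of the end-effector, hence of the held item. *)
Definition pending N k s a :=
  \sum_(q <- iota 1 N) ((q <= k) && goal_beyond k (cont s q))
    + ((a <= k) && goal_beyond k (hold s)).

Lemma pending_pns N k s p : 1 <= p <= N ->
  pending N k (pns s p) p = pending N k s p.
Proof.
move=> pN; have p_iota : p \in iota 1 N by rewrite mem_iota; lia.
rewrite /pending !(bigD1_seq p) ?iota_uniq //= hold_pns cont_pns eqxx.
rewrite (eq_bigr (fun q => nat_of_bool ((q <= k) && goal_beyond k (cont s q)))).
  by rewrite addnAC [X in X + _]addnC addnAC.
by move=> q /negPf qp; rewrite cont_pns qp.
Qed.

Lemma pending_leq_rcross N k P s a : within N P ->
  pending N k s a <= rcross k a P + pending N k (foldl pns s P) (last a P).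
Proof.
elim: P s a => [|p P IHP] s a //= /andP[pN PN].
have := IHP (pns s p) p PN; rewrite pending_pns // rcross_cons /pending.
by case: (goal_beyond _ (hold s)); lia.
Qed.

Lemma first_unstartedP G st :
  match first_unstarted G st with
  | Some c => [/\ c \in G, c \notin st
                & forall d, d \in G -> d \notin st -> c <= d]
  | None => {subset G <= st}
  end.
Proof.
rewrite /first_unstarted; set waiting := [seq c <- _ | _].
have mem_waiting c : (c \in waiting) = (c \in G) && (c \notin st).
  by rewrite mem_filter mem_sort andbC.
have waiting_sorted : sorted leq waiting.
  by apply: sorted_filter; [exact: leq_trans | apply/sort_sorted/leq_total].
case: waiting mem_waiting waiting_sorted => [|c rest] mem_waiting /=.
  move=> _ c cG; apply/negPn/negP => c_st.
  by have := mem_waiting c; rewrite cG c_st.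
rewrite (path_sortedE leq_trans) => /andP[/allP c_min _].
have := mem_waiting c; rewrite mem_head.
case/esym/andP => cG c_st; split=> // d dG d_st.
by have := mem_waiting d; rewrite dG d_st inE => /predU1P[->//|/c_min].
Qed.

Section Instance.

Variable pi : seq nat.
Hypothesis pi_inst : is_instance pi.
Implicit Types (G H L P : seq nat) (s : state).

Local Notation m := (size pi).
Local Notation cell q := (1 <= q <= m) (only parsing).
Local Notation pf := (pf pi).
Local Notation orb := (orb pi).
Local Notation cmin := (cmin pi).
Local Notation cmax := (cmax pi).
Local Notation nontriv := (nontriv pi).
Local Notation reps := (cyc_reps pi).
Local Notation gmin := (gmin pi).
Local Notation gmax := (gmax pi).
Local Notation groups := (groups pi).

(** * Cycles of an instance *)

Lemma mem_cells q : (q \in iota 1 m) = (1 <= q <= m).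
Proof. by rewrite mem_iota add1n ltnS. Qed.

Lemma pf_cell q : cell q -> cell (pf q).
Proof.
move=> q_cell; have q_lt : q.-1 < m by lia.
have : pf q \in pi by apply: mem_nth.
by rewrite (perm_mem pi_inst) mem_cells.
Qed.

Lemma pf_inj q r : cell q -> cell r -> pf q = pf r -> q = r.
Proof.
have pi_uniq : uniq pi by rewrite (perm_uniq pi_inst) iota_uniq.
move=> q_cell r_cell; have [q_lt r_lt] : q.-1 < m /\ r.-1 < m by lia.
by move/eqP; rewrite /Defs.pf nth_uniq // => /eqP; lia.
Qed.

Lemma orb_ufcycle q : cell q -> exists p,
  [/\ ufcycle pf (q :: p), orb q =i q :: p
    & forall x, x \in orb q -> cell x /\ orb x =i orb q].
Proof.
move=> q_cell; have [|x y||p pf_p p_cells] := @ufcycle_from _ pf (iota 1 m) q.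
- by move=> x; rewrite !mem_cells; apply: pf_cell.
- by rewrite !mem_cells; apply: pf_inj.
- by rewrite mem_cells.
have orbE x : x \in q :: p -> orb x =i q :: p.
  move=> xp; apply: traject_ufcycle => //; rewrite -[m in _ <= m](size_iota 1).
  by apply: uniq_leq_size p_cells; case/andP: pf_p.
have orb_q := orbE q (mem_head _ _); exists p.
split=> // x; rewrite orb_q => xp.
by split=> [|y]; [rewrite -mem_cells p_cells | rewrite orbE ?orb_q].
Qed.

Lemma eq_orb q x : cell q -> x \in orb q -> cell x /\ orb x =i orb q.
Proof. by case/orb_ufcycle => p [_ _]; apply. Qed.

Lemma orb_refl q : cell q -> q \in orb q.
Proof. by case/orb_ufcycle => p [_ -> _]; apply: mem_head. Qed.

Lemma pf_orb q : cell q -> pf q \in orb q.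
Proof.
case/orb_ufcycle => p [/andP[pf_p _] -> _].
by apply: mem_fcycle pf_p _; apply: mem_head.
Qed.

Lemma pf_preimage q : cell q -> exists2 x, x \in orb q & pf x = q.
Proof.
case/orb_ufcycle => p [/andP[/fpath_map pf_p _] orbE _].
have : q \in map pf (q :: p) by rewrite pf_p mem_rcons mem_head.
by case/mapP => x xp qE; exists x; rewrite ?orbE.
Qed.

Lemma cmin_mem q : cell q -> cmin q \in orb q.
Proof.
move=> q_cell; have := foldr_minn_mem q (orb q).
by rewrite inE => /orP[/eqP minE|//]; rewrite /Defs.cmin minE orb_refl.
Qed.

Lemma cmax_mem q : cell q -> cmax q \in orb q.
Proof.
move=> q_cell; have := foldr_maxn_mem q (orb q).
by rewrite inE => /orP[/eqP maxE|//]; rewrite /Defs.cmax maxE orb_refl.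
Qed.

Lemma cmin_le q x : x \in orb q -> cmin q <= x.
Proof.
by have := leqnn (cmin q); rewrite leq_foldr_minn /= => /andP[_ /allP]; apply.
Qed.

Lemma cmax_ge q x : x \in orb q -> x <= cmax q.
Proof.
by have := leqnn (cmax q); rewrite foldr_maxn_leq /= => /andP[_ /allP]; apply.
Qed.

Lemma cmin_leq q : cell q -> cmin q <= q.
Proof. by move=> q_cell; apply/cmin_le/orb_refl. Qed.

Lemma leq_cmax q : cell q -> q <= cmax q.
Proof. by move=> q_cell; apply/cmax_ge/orb_refl. Qed.

Lemma cmin_orb q x : cell q -> x \in orb q -> cmin x = cmin q.
Proof.
move=> q_cell /(eq_orb q_cell)[x_cell orbE]; apply/eqP.
by rewrite eqn_leq !cmin_le ?orbE ?cmin_mem // -orbE cmin_mem.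
Qed.

Lemma cmax_orb q x : cell q -> x \in orb q -> cmax x = cmax q.
Proof.
move=> q_cell /(eq_orb q_cell)[x_cell orbE]; apply/eqP.
by rewrite eqn_leq !cmax_ge ?orbE ?cmax_mem // -orbE cmax_mem.
Qed.

Lemma cmax_cmin q : cell q -> cmax (cmin q) = cmax q.
Proof. by move=> q_cell; apply/cmax_orb/cmin_mem. Qed.

Lemma nontriv_cell q : nontriv q -> cell q.
Proof. by case/andP. Qed.

Lemma nontriv_orb q x : nontriv q -> x \in orb q -> nontriv x.
Proof.
move=> /andP[q_cell pf_q] xq; have [x_cell orbE] := eq_orb q_cell xq.
rewrite /Defs.nontriv x_cell /=; apply: contra pf_q => /eqP pf_x.
have := orb_refl q_cell; rewrite -orbE => /trajectP[i _ ->].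
by rewrite iter_fix // pf_x.
Qed.

Lemma mem_reps c : (c \in reps) = nontriv c && (cmin c == c).
Proof. by rewrite mem_filter mem_cells andb_idr // => /andP[/nontriv_cell]. Qed.

Lemma rep_nontriv c : c \in reps -> nontriv c.
Proof. by rewrite mem_reps => /andP[]. Qed.

Lemma rep_cell c : c \in reps -> cell c.
Proof. by move/rep_nontriv/nontriv_cell. Qed.

Lemma cmin_repE c : c \in reps -> cmin c = c.
Proof. by rewrite mem_reps => /andP[_ /eqP]. Qed.

Lemma cmin_rep q : nontriv q -> cmin q \in reps.
Proof.
move=> nt_q; have q_cell := nontriv_cell nt_q; have min_q := cmin_mem q_cell.
by rewrite mem_reps (nontriv_orb nt_q min_q) (cmin_orb q_cell min_q) eqxx.
Qed.

Lemma mem_orb_rep c q : c \in reps ->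
  (q \in orb c) = nontriv q && (cmin q == c).
Proof.
move=> c_rep; have nt_c := rep_nontriv c_rep; have c_cell := nontriv_cell nt_c.
apply/idP/andP => [q_c|[/nontriv_cell q_cell /eqP <-]].
  by rewrite (nontriv_orb nt_c q_c) (cmin_orb c_cell q_c) cmin_repE.
have [_ ->] := eq_orb q_cell (cmin_mem q_cell); exact: orb_refl.
Qed.

Lemma cycle_from_rep c : c \in reps ->
  exists l, [/\ uniq (c :: l), map pf (c :: l) = rcons l c & c :: l =i orb c].
Proof.
move/rep_cell/orb_ufcycle => [l [/andP[/fpath_map pf_l l_uniq] orbE _]].
by exists l; split=> // q; rewrite orbE.
Qed.

Lemma rep_lt_cmax c : c \in reps -> c < cmax c.
Proof.
move=> c_rep; have /andP[c_cell pf_c] := rep_nontriv c_rep.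
have pf_c_orb := pf_orb c_cell.
have := cmin_le pf_c_orb; have := cmax_ge pf_c_orb; have := leq_cmax c_cell.
rewrite (cmin_repE c_rep); lia.
Qed.

Lemma reps_sorted : sorted ltn reps.
Proof. exact/(sorted_filter ltn_trans)/iota_ltn_sorted. Qed.

Lemma reps_uniq : uniq reps.
Proof. by rewrite filter_uniq ?iota_uniq. Qed.

(** * Cycle groups *)

Lemma gmin_mem G : G != [::] -> gmin G \in G.
Proof.
case: G => // c G _; have := foldr_minn_mem c (c :: G).
by rewrite /Defs.gmin /= !inE => /orP[->|].
Qed.

Lemma gmin_le G c : c \in G -> gmin G <= c.
Proof.
by have := leqnn (gmin G); rewrite leq_foldr_minn /= => /andP[_ /allP]; apply.
Qed.

Lemma gmax_leq G k : (gmax G <= k) = all (fun c => cmax c <= k) G.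
Proof. by rewrite foldr_maxn_leq /= all_map. Qed.

Lemma gmax_ge G c : c \in G -> cmax c <= gmax G.
Proof. by have := leqnn (gmax G); rewrite gmax_leq => /allP; apply. Qed.

Lemma gmin_cat G H : G != [::] -> H != [::] ->
  gmin (G ++ H) = minn (gmin G) (gmin H).
Proof.
move=> G_neq0 H_neq0; apply/eqP; rewrite eqn_leq leq_min.
rewrite !gmin_le ?mem_cat ?gmin_mem ?orbT //=.
have : gmin (G ++ H) \in G ++ H by apply: gmin_mem; case: (G) G_neq0.
by rewrite mem_cat geq_min => /orP[]/gmin_le->; rewrite ?orbT.
Qed.

Lemma gmax_cat G H : gmax (G ++ H) = maxn (gmax G) (gmax H).
Proof.
apply/eqP; rewrite eqn_leq gmax_leq all_cat -!gmax_leq leq_maxl leq_maxr /=.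
by rewrite geq_max !gmax_leq -all_cat -gmax_leq.
Qed.

Definition spans G k := has (fun c => c <= k < cmax c) G.

Definition gapless G := forall k, spans G k = (gmin G <= k < gmax G).

Lemma gapless_cat G H : G != [::] -> H != [::] -> ginter pi G H ->
  gapless G -> gapless H -> gapless (G ++ H).
Proof.
move=> G_neq0 H_neq0 /andP[le_GH le_HG] gapG gapH k.
rewrite /spans has_cat -!/(spans _ k) gapG gapH gmin_cat // gmax_cat; lia.
Qed.

Definition apart := pairwise (fun G H => ~~ ginter pi G H).

Lemma merge_into_some G gs gs' : merge_into pi G gs = Some gs' ->
  exists H rest, [/\ perm_eq gs (H :: rest),
    perm_eq gs' ((G ++ H) :: rest) & ginter pi G H].
Proof.
elim: gs gs' => // K gs IHgs gs' /=.
case: ifP => [GK [<-]|_]; first by exists K, gs.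
case merge: merge_into => [gs''|//] [<-].
have [H [rest [perm_gs perm_gs'' GH]]] := IHgs _ merge.
exists H, (K :: rest); split=> //; apply/permP => a /=.
- by rewrite (permP perm_gs) /= addnCA.
- by rewrite (permP perm_gs'') /= addnCA.
Qed.

Lemma merge_into_none G gs : merge_into pi G gs = None ->
  all (fun H => ~~ ginter pi G H) gs.
Proof.
by elim: gs => //= H gs IHgs; case: ifP => //=; case: merge_into IHgs => //= ->.
Qed.

Lemma merge_step_some gs gs' : merge_step pi gs = Some gs' -> exists G H rest,
  [/\ perm_eq gs [:: G, H & rest], perm_eq gs' ((G ++ H) :: rest)
    & ginter pi G H].
Proof.
elim: gs gs' => // K gs IHgs gs' /=; case merge: merge_into => [gs''|].
  have [H [rest [perm_gs perm_gs'' KH]]] := merge_into_some merge.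
  by case=> <-; exists K, H, rest; rewrite perm_cons.
case step: merge_step => [gs''|//] [<-].
have [G [H [rest [perm_gs perm_gs'' GH]]]] := IHgs _ step.
exists G, H, (K :: rest); split=> //; apply/permP => a /=.
- by rewrite (permP perm_gs) /=; lia.
- by rewrite (permP perm_gs'') /= addnCA.
Qed.

Lemma merge_step_none gs : merge_step pi gs = None -> apart gs.
Proof.
elim: gs => //= G gs IHgs; case merge: merge_into => [//|].
by rewrite (merge_into_none merge); case: merge_step IHgs => //= ->.
Qed.

Definition grouping gs :=
  [/\ perm_eq (flatten gs) reps, [::] \notin gs & {in gs, forall G, gapless G}].

Lemma merge_step_grouping gs gs' : merge_step pi gs = Some gs' -> grouping gs ->
  grouping gs' /\ size gs = (size gs').+1.
Proof.
case/merge_step_some => G [H [rest [perm_gs perm_gs' GH]]].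
case=> flat_gs gs_neq0 gapless_gs.
split; last by rewrite (perm_size perm_gs) (perm_size perm_gs').
have [G_gs H_gs] : G \in gs /\ H \in gs.
  by rewrite !(perm_mem perm_gs) !inE !eqxx orbT.
have rest_gs K : K \in rest -> K \in gs.
  by rewrite (perm_mem perm_gs) !inE => ->; rewrite !orbT.
have G_neq0 : G != [::] by apply: contraNneq gs_neq0 => <-.
have H_neq0 : H != [::] by apply: contraNneq gs_neq0 => <-.
split.
- rewrite (permPl (perm_flatten perm_gs')) /= -catA.
  by rewrite -(permPr flat_gs) (permPr (perm_flatten perm_gs)).
- rewrite (perm_mem perm_gs') inE negb_or (contra (rest_gs _)) // andbT.
  by case: (G) G_neq0.
- move=> K; rewrite (perm_mem perm_gs') inE.
  case/predU1P => [->|/rest_gs/gapless_gs //].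
  by apply: gapless_cat => //; apply: gapless_gs.
Qed.

Lemma merge_iter_grouping n gs : grouping gs -> size gs <= n ->
  grouping (merge_iter pi n gs) /\ apart (merge_iter pi n gs).
Proof.
elim: n gs => [|n IHn] gs gs_grouping; first by case: gs gs_grouping.
move=> /= gs_n; case step: merge_step => [gs'|]; last first.
  by split; last exact: merge_step_none.
have [gs'_grouping gs'_size] := merge_step_grouping step gs_grouping.
by apply: IHn; rewrite // -ltnS -gs'_size.
Qed.

Lemma groupsP : grouping groups /\ apart groups.
Proof.
apply: merge_iter_grouping; last by rewrite size_map.
split=> [||G /mapP[c _ ->] k].
- by rewrite flatten_seq1.
- by apply/mapP => -[].
- by rewrite /spans /Defs.gmin /Defs.gmax /= minnn maxn0 orbF.
Qed.

Lemma groups_gapless G : G \in groups -> gapless G.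
Proof. by have [[_ _ gapless_gs] _] := groupsP => /gapless_gs. Qed.

Lemma group_sub_reps G : G \in groups -> {subset G <= reps}.
Proof.
have [[perm_reps _ _] _] := groupsP => G_gs c cG; rewrite -(perm_mem perm_reps).
by apply/flattenP; exists G.
Qed.

Lemma gmin_group G : G \in groups -> gmin G \in G.
Proof.
have [[_ gs_neq0 _] _] := groupsP => G_gs.
by apply: gmin_mem; apply: contraNneq gs_neq0 => <-.
Qed.

Lemma gmin_lt_gmax G : G \in groups -> gmin G < gmax G.
Proof.
move=> G_gs; have min_G := gmin_group G_gs.
exact: leq_trans (rep_lt_cmax (group_sub_reps G_gs min_G)) (gmax_ge min_G).
Qed.

Lemma rep_in_group c : c \in reps -> exists2 G, G \in groups & c \in G.
Proof.
have [[perm_reps _ _] _] := groupsP; rewrite -(perm_mem perm_reps).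
by case/flattenP => G; exists G.
Qed.

Lemma cycle_in_group_interval G q : cell q -> cmin q \in G ->
  gmin G <= q <= gmax G.
Proof.
move=> q_cell min_G; rewrite (leq_trans (gmin_le min_G)) ?cmin_leq //=.
by rewrite (leq_trans (leq_cmax q_cell)) // -cmax_cmin // gmax_ge.
Qed.

Lemma groups_intersecting_eq G H x : G \in groups -> H \in groups ->
  gmin G <= x <= gmax G -> gmin H <= x <= gmax H -> G = H.
Proof.
have [_ /(pairwiseP [::]) apart_gs] := groupsP.
have meet K K' : gmin K <= x <= gmax K -> gmin K' <= x <= gmax K' ->
    ginter pi K K'.
  by rewrite /ginter; lia.
move=> /(nthP [::])[i i_gs <-] /(nthP [::])[j j_gs <-] x_i x_j.
case: (ltngtP i j) => [ij|ji|->//].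
- by have := apart_gs i j i_gs j_gs ij; rewrite meet.
- by have := apart_gs j i j_gs i_gs ji; rewrite meet.
Qed.

Lemma mem_group G c : G \in groups -> c \in reps ->
  (c \in G) = (gmin G <= c <= gmax G).
Proof.
move=> G_gs c_rep; have in_interval K : c \in K -> gmin K <= c <= gmax K.
  by move=> cK; apply: cycle_in_group_interval; rewrite ?rep_cell ?cmin_repE.
apply/idP/idP => [/in_interval//|c_G]; have [H H_gs cH] := rep_in_group c_rep.
by rewrite (groups_intersecting_eq G_gs H_gs c_G) ?in_interval.
Qed.

Lemma spans_reps G k : G \in groups -> gmin G <= k <= gmax G ->
  spans reps k = (k < gmax G).
Proof.
move=> G_gs k_G; apply/idP/idP => [/hasP[c c_rep c_k]|k_lt].
  have [H H_gs cH] := rep_in_group c_rep.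
  have k_H : gmin H <= k < gmax H.
    by have := gmin_le cH; have := gmax_ge cH; lia.
  by rewrite (@groups_intersecting_eq G H k) //; lia.
have /hasP[c cG c_k] : spans G k by rewrite groups_gapless //; lia.
by apply/hasP; exists c => //; apply: group_sub_reps cG.
Qed.

Lemma group_ofP q : nontriv q ->
  group_of pi q \in groups /\ cmin q \in group_of pi q.
Proof.
move=> nt_q; have q_cell := nontriv_cell nt_q.
have [G G_gs min_G] := rep_in_group (cmin_rep nt_q).
have q_G := cycle_in_group_interval q_cell min_G.
pose around K := gmin K <= q <= gmax K.
have has_around : has around groups by apply/hasP; exists G.
have of_gs : group_of pi q \in groups by rewrite mem_nth // -has_find.
by rewrite (groups_intersecting_eq of_gs G_gs (nth_find [::] has_around) q_G).
Qed.

Lemma group_right_of G c : G \in groups -> c \in reps -> gmax G < c ->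
  exists2 K, K \in groups & gmax G < gmin K <= c.
Proof.
move=> G_gs c_rep Gc; have [K K_gs cK] := rep_in_group c_rep.
have /andP[min_K max_K] : gmin K <= c <= gmax K by rewrite -mem_group.
exists K => //; rewrite min_K andbT ltnNge; apply/negP => le_KG.
have GK : G = K.
  apply: (@groups_intersecting_eq _ _ (gmax G)) => //; last by lia.
  by have := gmin_lt_gmax G_gs; lia.
by move: max_K; rewrite -GK; lia.
Qed.

Lemma next_groupP G : G \in groups ->
  match next_group pi G with
  | Some H => [/\ gmin H \in reps, gmax G < gmin H
                & forall c, c \in reps -> gmax G < c -> gmin H <= c]
  | None => forall c, c \in reps -> c <= gmax G
  end.
Proof.
move=> G_gs; rewrite /next_group; set right_groups := [seq H <- groups | _].
have right_of c : c \in reps -> gmax G < c ->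
    exists2 K, K \in right_groups & gmin K <= c.
  move=> c_rep /(group_right_of G_gs c_rep)[K K_gs /andP[GK Kc]].
  by exists K; rewrite // mem_filter GK.
case right_def: right_groups => [|K0 rest].
  move=> c c_rep; rewrite leqNgt; apply/negP => /(right_of c c_rep)[K].
  by rewrite right_def.
rewrite -right_def; set leftmost := foldr _ _ _.
set is_leftmost := (fun H => _ == leftmost).
have has_leftmost : has is_leftmost right_groups.
  have : leftmost \in map gmin right_groups.
    have := foldr_minn_mem (gmin K0) (map gmin right_groups).
    rewrite -/leftmost inE => /predU1P[->|//].
    by rewrite right_def map_f ?mem_head.
  by case/mapP => K K_right minK; apply/hasP; exists K => //; apply/eqP.
set H := nth _ _ _.
have H_leftmost : gmin H = leftmost := eqP (nth_find [::] has_leftmost).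
have : H \in right_groups by rewrite mem_nth // -has_find.
rewrite mem_filter => /andP[GH H_gs]; split=> // [|c c_rep Gc].
  exact: group_sub_reps (gmin_group H_gs).
have [K K_right le_Kc] := right_of c c_rep Gc.
apply: leq_trans le_Kc; rewrite H_leftmost.
have := leqnn leftmost; rewrite leq_foldr_minn => /allP; apply.
by rewrite inE map_f ?orbT.
Qed.

(** * Lower bounds *)

Definition ntcells := [seq q <- iota 1 m | nontriv q].

Lemma mem_ntcells q : (q \in ntcells) = nontriv q.
Proof. by rewrite mem_filter mem_cells andb_idr // => /nontriv_cell. Qed.

Lemma ntcells_uniq : uniq ntcells.
Proof. by rewrite filter_uniq ?iota_uniq. Qed.

Lemma cont_init q : cell q -> cont (init pi) q = Some (pf q).
Proof. by move=> q_cell /=; rewrite q_cell. Qed.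

Lemma valid_visits P q : valid pi P -> nontriv q -> q \in P.
Proof.
move=> [_ [_ sorted_P]] /andP[q_cell]; apply: contraR => qP; apply/eqP.
have := sorted_P q q_cell; rewrite /run cont_foldl_pns // cont_init //.
by case.
Qed.

(* If the first visited cell [a] of the cycle were not visited again, it would
   keep the item put there at the first visit, when the end-effector cannot yet
   hold item [a]: the item is still in its initial, so far unvisited cell. *)
Lemma cycle_visited_twice P c : valid pi P -> nontriv c ->
  exists2 a, a \in orb c & 1 < count_mem a P.
Proof.
move=> P_valid nt_c; have c_cell := nontriv_cell nt_c.
have meets_c : has (mem (orb c)) P.
  by apply/hasP; exists c; [apply: valid_visits | apply: orb_refl].
case: P_valid => _ [_].
case: (split_find meets_c) => a P1 P2 /= a_c P1_c sorted_P; exists a => //.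
rewrite count_cat -cats1 count_cat /= eqxx addn0 addn1 addSn ltnS.
suff aP2 : a \in P2 by rewrite addn_gt0 -!has_count !has_pred1 aP2 orbT.
have [a_cell orbE] := eq_orb c_cell a_c.
have [b b_a pf_b] := pf_preimage a_cell.
have [b_cell _] := eq_orb a_cell b_a.
have bP1 : b \notin P1.
  by apply: contra P1_c => bP1; apply/hasP; exists b; rewrite //= -orbE.
apply/negPn/negP => aP2; have := sorted_P a a_cell.
rewrite /run foldl_cat cont_foldl_pns // foldl_rcons cont_pns eqxx.
apply: hold_foldl_pns_neq bP1 _ _ => // q /=.
by case: ifP => // q_cell [pf_q]; apply: pf_inj; rewrite // pf_b.
Qed.

Lemma leq_size_valid P : valid pi P -> size ntcells + size reps <= size P.
Proof.
move=> P_valid; pose revisited := [seq q <- ntcells | 1 < count_mem q P].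
have reps_revisited : size reps <= size revisited.
  rewrite -(size_map cmin revisited).
  apply: uniq_leq_size reps_uniq _ => c c_rep.
  have [a] := cycle_visited_twice P_valid (rep_nontriv c_rep).
  rewrite mem_orb_rep // => /andP[nt_a /eqP <-] aP.
  by apply: map_f; rewrite mem_filter aP mem_ntcells.
apply: leq_trans (_ : size (ntcells ++ revisited) <= _).
  by rewrite size_cat leq_add2l.
have [|s s_sub perm_s] := (count_subseqP (ntcells ++ revisited) P).1.
  have revisited_uniq : uniq revisited by rewrite filter_uniq ?ntcells_uniq.
  move=> q; rewrite count_cat (count_uniq_mem _ ntcells_uniq).
  rewrite (count_uniq_mem _ revisited_uniq) mem_ntcells mem_filter mem_ntcells.
  case: (boolP (nontriv q)) => [nt_q|]; last by rewrite andbF.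
  have := valid_visits P_valid nt_q; rewrite -has_pred1 has_count.
  by case: count => [|[]].
by rewrite (perm_size perm_s) size_subseq.
Qed.

(* Edge [k] lies between two groups, or between cell 1 and the first group. *)
Definition gap k := ~~ spans reps k && has (ltn k) reps.

Lemma pending_init_unspanned k : ~~ spans reps k -> pending m k (init pi) 1 = 0.
Proof.
move=> unspanned; rewrite /pending /= andbF addn0; apply: big1_seq => q /=.
rewrite mem_cells => q_cell; rewrite q_cell /=; apply/eqP; rewrite eqb0.
apply: contra unspanned => /andP[qk k_pf]; apply/hasP; exists (cmin q).
  apply: cmin_rep; rewrite /Defs.nontriv q_cell neq_ltn.
  by rewrite (leq_ltn_trans qk k_pf) orbT.
rewrite cmax_cmin // (leq_trans (cmin_leq q_cell) qk).
exact: leq_trans k_pf (cmax_ge (pf_orb q_cell)).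
Qed.

Definition needed_rcross k := pending m k (init pi) 1 + gap k.

Lemma leq_rcross_valid P k : valid pi P -> 0 < k ->
  needed_rcross k <= rcross k 1 P.
Proof.
move=> P_valid k_gt0; have [P_cells [hold_P sorted_P]] := P_valid.
have no_pending_P : pending m k (run pi P) (last 1 P) = 0.
  rewrite /pending hold_P andbF addn0; apply: big1_seq => q /=.
  by rewrite mem_cells => /sorted_P -> /=; case: leqP.
have := pending_leq_rcross k (init pi) 1 P_cells.
rewrite -/(run pi P) no_pending_P addn0 /needed_rcross.
case: (boolP (gap k)) => [|_]; last by rewrite addn0.
case/andP => unspanned /hasP[c c_rep kc] _; rewrite pending_init_unspanned //.
apply: rcross_gt0 kc => //.
exact: valid_visits P_valid (rep_nontriv c_rep).
Qed.

(** * The run of OptPlanLOR *)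

Local Notation rep n := (nth 0 reps n).
Local Notation top n := (gmax (take n reps)).

Lemma rep_mem n : (rep n \in reps) = (n < size reps).
Proof.
case: ltnP => [/mem_nth->//|le_n]; rewrite nth_default //.
by apply/negP => /rep_cell.
Qed.

Lemma rep_lt i j : i < j -> j < size reps -> rep i < rep j.
Proof.
move=> ij j_lt; apply: (sorted_ltn_nth ltn_trans 0 reps_sorted) => //.
exact: ltn_trans j_lt.
Qed.

Lemma mem_take_reps n c : n < size reps -> c \in reps ->
  (c \in take n reps) = (c < rep n).
Proof.
move=> n_lt c_rep; rewrite in_take //.
have c_lt : index c reps < size reps by rewrite index_mem.
rewrite -{2}(nth_index 0 c_rep); case: (ltngtP (index c reps) n) => [lt|gt|->].
- by rewrite rep_lt.
- by rewrite ltnNge ltnW ?rep_lt.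
- by rewrite ltnn.
Qed.

Lemma rep_notin_take n : rep n \notin take n reps.
Proof.
apply/negP => rep_take; have := mem_take rep_take; rewrite rep_mem => n_lt.
by move: rep_take; rewrite mem_take_reps ?rep_mem // ltnn.
Qed.

Lemma notin_take_reps n c : c \in reps -> c \notin take n reps ->
  n < size reps /\ rep n <= c.
Proof.
move=> c_rep c_new; have n_lt : n < size reps.
  by rewrite ltnNge; apply: contra c_new => /take_oversize->.
by move: c_new; rewrite mem_take_reps // -leqNgt.
Qed.

Lemma topS n : n < size reps -> top n.+1 = maxn (top n) (cmax (rep n)).
Proof.
move=> n_lt; rewrite (take_nth 0 n_lt) -cats1 gmax_cat.
by rewrite {2}/Defs.gmax /= maxn0.
Qed.

Lemma unspanned_after_top n k : top n <= k -> (n < size reps -> k < rep n) ->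
  ~~ spans reps k.
Proof.
move=> le_top lt_rep; apply/hasP => -[c c_rep /andP[ck]].
apply/negP; rewrite -leqNgt; case: (boolP (c \in take n reps)) => [c_old|c_new].
  exact: leq_trans (gmax_ge c_old) le_top.
by have [/lt_rep] := notin_take_reps c_rep c_new; lia.
Qed.

Lemma top_leq n k : (forall c, c \in take n reps -> c <= k) ->
  ~~ spans reps k -> top n <= k.
Proof.
move=> le_k unspanned; rewrite gmax_leq; apply/allP => c c_take; rewrite leqNgt.
apply: contra unspanned => kc.
apply/hasP; exists c; first exact: mem_take c_take.
by rewrite le_k.
Qed.

Lemma gap_after_top n k : n < size reps -> top n <= k < rep n -> gap k.
Proof.
move=> n_lt /andP[top_k k_rep]; rewrite /gap (unspanned_after_top top_k) //=.
by apply/hasP; exists (rep n); rewrite ?rep_mem.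
Qed.

Lemma hasN_take_reps n k : top n <= k -> has (ltn k) (take n reps) = false.
Proof.
move=> top_k; apply/hasP => -[c c_take /= kc].
have := gmax_ge c_take; have := rep_lt_cmax (mem_take c_take); lia.
Qed.

Definition started n q := nontriv q && (cmin q \in take n reps).

Lemma started_next_cycle n q : n < size reps -> q \in orb (rep n) ->
  started n q = false.
Proof.
move=> n_lt; rewrite mem_orb_rep ?rep_mem // => /andP[_ /eqP min_q].
by rewrite /started min_q (negPf (rep_notin_take n)) andbF.
Qed.

Lemma started_rep n : n < size reps -> started n (rep n) = false.
Proof.
by move=> n_lt; rewrite started_next_cycle // orb_refl // rep_cell ?rep_mem.
Qed.

Lemma startedS n q : n < size reps ->
  started n.+1 q = started n q || (q \in orb (rep n)).
Proof.
move=> n_lt; rewrite mem_orb_rep ?rep_mem // /started (take_nth 0 n_lt).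
by rewrite mem_rcons inE andb_orr orbC.
Qed.

Lemma started_cell n q : started n q -> cell q.
Proof. by case/andP => /nontriv_cell. Qed.

Lemma started_le_top n q : started n q -> q <= top n.
Proof.
case/andP => /nontriv_cell q_cell min_take.
by rewrite (leq_trans (leq_cmax q_cell)) // -cmax_cmin // gmax_ge.
Qed.

(* With [n] cycles started, [L] lists the cells that the end-effector would
   visit if no further cycle were started: the goal of the held item, then the
   goal of the item found there, and so on until an empty cell. *)
Definition route n s L :=
  [/\ hold s :: map (cont s) L = rcons (map Some L) None,
      uniq L, all (started n) L
    & forall q, cell q -> q \notin L ->
        cont s q = Some (if started n q then q else pf q)].

Lemma route_hold n s L : route n s L -> hold s = ohead L.
Proof. by case; case: L => [|g L] [-> _]. Qed.

Lemma route_init : route 0 (init pi) [::].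
Proof. by split=> // q q_cell _; rewrite cont_init // /started take0 andbF. Qed.

Lemma route0 s L : route 0 s L -> L = [::].
Proof. by case=> _ _; case: L => //= g L; rewrite /started take0 andbF. Qed.

Lemma route_started n s g L : route n s (g :: L) -> started n g.
Proof. by case=> _ _ /andP[]. Qed.

Lemma route_deliver n s g L : route n s (g :: L) -> route n (pns s g) L.
Proof.
move=> L_route; have hold_g := route_hold L_route.
case: L_route => -[_ carried] /andP[gL L_uniq].
move=> /andP[g_started L_started] settled; split=> // [|q q_cell qL].
  rewrite hold_pns -carried; congr (_ :: _); apply/eq_in_map => q qL.
  by rewrite cont_pns; case: eqP gL => // <-; rewrite qL.
rewrite cont_pns; case: eqP => [->|/eqP qg]; first by rewrite hold_g g_started.
by apply: settled; rewrite // inE negb_or qg.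
Qed.

Lemma route_next_cycle n s L q : route n s L -> n < size reps ->
  q \in orb (rep n) -> q \notin L /\ cont s q = Some (pf q).
Proof.
move=> [_ _ /allP L_started settled] n_lt q_orb.
have q_unstarted := started_next_cycle n_lt q_orb.
have qL : q \notin L by apply/negP => /L_started; rewrite q_unstarted.
have rep_reps : rep n \in reps by rewrite rep_mem.
have [q_cell _] := eq_orb (rep_cell rep_reps) q_orb.
by rewrite settled ?q_unstarted.
Qed.

Lemma route_start n s L : route n s L -> n < size reps ->
  exists2 l, route n.+1 (pns s (rep n)) (rcons l (rep n) ++ L)
    & rcons l (rep n) =i orb (rep n).
Proof.
move=> L_route n_lt; have rep_reps : rep n \in reps by rewrite rep_mem.
have [l [ul_uniq pf_l l_orb]] := cycle_from_rep rep_reps.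
have next_cycle := route_next_cycle L_route n_lt.
case: L_route => carried L_uniq L_started settled.
set u := rep n in l_orb rep_reps ul_uniq pf_l next_cycle *.
have u_orb : u \in orb u by rewrite orb_refl ?rep_cell.
have cont_other q : q != u -> cont (pns s u) q = cont s q.
  by move=> /negPf qu; rewrite cont_pns qu.
exists l; last by move=> q; rewrite mem_rcons l_orb.
split.
- have cont_l : map (cont (pns s u)) l = map Some (map pf l).
    rewrite -map_comp; apply/eq_in_map => q ql; rewrite cont_other.
      by case: (next_cycle q) => //; rewrite -l_orb inE ql orbT.
    by apply: contraTneq ql => ->; case/andP: ul_uniq.
  have cont_L : map (cont (pns s u)) L = map (cont s) L.
    apply/eq_in_map => q qL; rewrite cont_other //; apply: contraTneq qL => ->.
    by case: (next_cycle u).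
  have [_ cont_u] := next_cycle u u_orb.
  rewrite hold_pns cont_u map_cat map_rcons cont_l cont_L.
  by rewrite cont_pns eqxx cat_rcons carried map_cat rcons_cat -pf_l.
- rewrite cat_uniq rcons_uniq L_uniq andbT -cons_uniq ul_uniq /=.
  apply/hasPn => q; apply: contraL.
  by rewrite /= mem_rcons l_orb => /next_cycle[].
- rewrite all_cat; apply/andP; split; apply/allP => q.
    by rewrite mem_rcons l_orb startedS // => ->; rewrite orbT.
  by move/(allP L_started) => q_started; rewrite startedS // q_started.
- move=> q q_cell; rewrite mem_cat negb_or mem_rcons l_orb => /andP[q_orb qL].
  rewrite startedS // (negPf q_orb) orbF cont_other; first exact: settled.
  by apply: contraNneq q_orb => ->.
Qed.

Definition misplaced s := count (fun q => cont s q != Some q) ntcells.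

Lemma misplaced_init : misplaced (init pi) = size ntcells.
Proof.
apply/eqP; rewrite -all_count; apply/allP => q.
rewrite mem_ntcells => /andP[q_cell pf_q].
by rewrite cont_init // (inj_eq Some_inj).
Qed.

Lemma misplaced_start n s L : route n s L -> n < size reps ->
  misplaced (pns s (rep n)) = misplaced s.
Proof.
move=> L_route n_lt; have rep_reps : rep n \in reps by rewrite rep_mem.
have /andP[u_cell pf_u] := rep_nontriv rep_reps.
have [rep_L cont_rep] := route_next_cycle L_route n_lt (orb_refl u_cell).
apply: eq_count => q; rewrite cont_pns; case: (q =P rep n) => // ->.
rewrite cont_rep (inj_eq Some_inj) pf_u (route_hold L_route).
exact: ohead_neq.
Qed.

Lemma misplaced_deliver n s g L : route n s (g :: L) ->
  misplaced s = (misplaced (pns s g)).+1.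
Proof.
move=> L_route; have hold_g := route_hold L_route.
have := route_hold (route_deliver L_route); rewrite hold_pns => cont_g.
have /andP[nt_g _] := route_started L_route.
have g_nt : g \in ntcells by rewrite mem_ntcells.
rewrite /misplaced !(permP (perm_to_rem g_nt)) /= cont_pns eqxx.
rewrite hold_g eqxx add0n cont_g.
have -> : ohead L != Some g by case: L_route => _ /andP[/ohead_neq].
rewrite add1n; congr _.+1; apply: eq_in_count => q.
rewrite mem_rem_uniq ?ntcells_uniq // inE => /andP[/negPf qg _].
by rewrite cont_pns qg.
Qed.

Definition starts_next n a L :=
  (n < size reps)
  && (if L is g :: _ then (a == top n) || (a < rep n < g) else true).

(* Cell [q] is the maximum of its group iff no cycle spans edge [q]; OptPlanLOR
   jumps whenever it leaves such a cell, so only the maximum [top n] of the last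
   started group may still be visited. While cycles remain to be started,
   [top n] has not been left yet, and the route ends at the only empty cell, the
   first pick-up cell [rep 0]; in particular it is not empty. *)
Definition on_track n a L := 0 < n ->
  [/\ started n a,
      forall q, q \in a :: L -> ~~ spans reps q -> top n <= q
    & n < size reps ->
        [/\ a < rep n, (top n \in L) = (a != top n) & last 0 L = rep 0]].

Lemma on_track_deliver n s a g L :
    route n s (g :: L) -> on_track n a (g :: L) ->
    ~~ starts_next n a (g :: L) ->
  on_track n g L.
Proof.
move=> L_route L_track no_start n_gt0; have g_started := route_started L_route.
have [_ below_top ahead] := L_track n_gt0; split=> // [q qL|n_lt].
  by apply: below_top; rewrite inE qL orbT.
have [a_rep top_L last_L] := ahead n_lt.
move: no_start; rewrite /starts_next n_lt a_rep negb_or -leqNgt.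
case/andP => a_top g_rep; have {}g_rep : g < rep n.
  rewrite ltn_neqAle g_rep andbT; apply: contraTneq g_started => ->.
  by rewrite started_rep.
have gL : g \notin L by case: L_route => _ /andP[].
split=> //.
  move: top_L; rewrite a_top inE eq_sym; case: eqP => //= <- _.
  exact: negbTE.
case: (L) last_L top_L => //= last_g; rewrite a_top inE => /eqP topE.
have rep0_lt : rep 0 < rep n by apply: rep_lt.
have rep0_rep : rep 0 \in reps by rewrite rep_mem; apply: leq_ltn_trans n_lt.
have rep0_take : rep 0 \in take n reps by rewrite mem_take_reps.
have := gmax_ge rep0_take; have := rep_lt_cmax rep0_rep.
by rewrite topE last_g; lia.
Qed.

Lemma starts_next_held n s a L :
    route n s L -> on_track n a L -> starts_next n a L -> 0 < n ->
  exists g L', [/\ L = g :: L', a < rep n & a = top n \/ rep n < g].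
Proof.
move=> L_route L_track /andP[n_lt starts] n_gt0.
have [_ _ /(_ n_lt)[a_rep _ last_L]] := L_track n_gt0.
case: L starts {L_route L_track} last_L => [|g L] starts last_L.
  have : rep 0 \in reps by rewrite rep_mem; apply: leq_ltn_trans n_lt.
  by rewrite -last_L => /rep_cell.
exists g, L; split=> //; case/orP: starts => [/eqP|/andP[]]; auto.
Qed.

(* After a jump from [top n], no cell of the remaining route is [top n]; after a
   switch in passing, the route reaches beyond [rep n]. *)
Lemma rep_leq_unspanned_route n s a L q :
    route n s L -> on_track n a L -> starts_next n a L ->
  q \in L -> ~~ spans reps q -> rep n <= q.
Proof.
move=> L_route L_track starts qL unspanned; have n_gt0 : 0 < n.
  by case: n L_route {L_track starts} => // /route0 L0; rewrite L0 in qL.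
have n_lt : n < size reps by case/andP: starts.
have [g [L' [LE a_rep how]]] := starts_next_held L_route L_track starts n_gt0.
have [_ /(_ q) top_q /(_ n_lt)[_ top_L _]] := L_track n_gt0.
have {}top_q : top n <= q by apply: top_q; rewrite // inE qL orbT.
case: L_route => _ _ /allP L_started _.
case: how => [aE|rep_g].
  have qE : q = top n.
    by apply/eqP; rewrite eqn_leq top_q started_le_top ?L_started.
  by move: top_L; rewrite -qE qL qE aE eqxx.
have : started n g by apply: L_started; rewrite LE mem_head.
by move/started_le_top; lia.
Qed.

Lemma on_track_start n s a L l :
    route n s L -> on_track n a L -> starts_next n a L ->
    rcons l (rep n) =i orb (rep n) ->
  on_track n.+1 (rep n) (rcons l (rep n) ++ L).
Proof.
move=> L_route L_track starts l_orb _.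
have n_lt : n < size reps by case/andP: starts.
have rep_reps : rep n \in reps by rewrite rep_mem.
have u_cell := rep_cell rep_reps; have u_cmax := rep_lt_cmax rep_reps.
split=> [|q q_route unspanned|n1_lt].
- by rewrite startedS // orb_refl // orbT.
- apply: top_leq (unspanned) => c c_take.
  have le_c : c <= rep n.
    move: c_take; rewrite (take_nth 0 n_lt) mem_rcons inE.
    case/predU1P => [->//|c_take].
    by apply: ltnW; rewrite -mem_take_reps // (mem_take c_take).
  apply: leq_trans le_c _.
  move: q_route; rewrite inE mem_cat l_orb => /or3P[/eqP->//|q_orb|qL].
    by rewrite -(cmin_repE rep_reps) cmin_le.
  exact: rep_leq_unspanned_route L_route L_track starts qL unspanned.
- split; first exact: rep_lt.
  + have -> : rep n != top n.+1 by rewrite topS //; apply/eqP; lia.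
    rewrite topS // mem_cat l_orb /maxn; case: ltnP => [_|cmax_top].
      by rewrite cmax_mem.
    have n_gt0 : 0 < n.
      by case: (n) cmax_top u_cmax => //; rewrite take0; case: cmax.
    have [_ _ /(_ n_lt)[a_rep -> _]] := L_track n_gt0.
    by apply/orP; right; apply/eqP; lia.
  + rewrite last_cat last_rcons; case: (posnP n) => [n0|n_gt0].
      by move: L_route; rewrite n0 => /route0->.
    have [g [L' [LE _ _]]] := starts_next_held L_route L_track starts n_gt0.
    by have [_ _ /(_ n_lt)[_ _]] := L_track n_gt0; rewrite LE.
Qed.

Lemma first_unstarted_take G n : {subset G <= reps} ->
    (forall c, c \in G -> c \notin take n reps -> rep n \in G) ->
  first_unstarted G (rev (take n reps)) =
    if rep n \in G then Some (rep n) else None.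
Proof.
move=> G_reps rep_G; have := first_unstartedP G (rev (take n reps)).
case: first_unstarted => [c|sub_G].
  rewrite mem_rev => -[cG c_new c_min]; rewrite (rep_G c) //; congr Some.
  have [_ rep_c] := notin_take_reps (G_reps c cG) c_new.
  apply/eqP; rewrite eqn_leq rep_c andbT.
  by apply: c_min; rewrite ?mem_rev ?rep_notin_take // (rep_G c).
by case: ifP => // /sub_G; rewrite mem_rev (negPf (rep_notin_take n)).
Qed.

Lemma first_unstarted_group n g : started n g ->
  first_unstarted (group_of pi g) (rev (take n reps)) =
    if rep n \in group_of pi g then Some (rep n) else None.
Proof.
case/andP => nt_g min_take; have [G_gs min_G] := group_ofP nt_g.
apply: first_unstarted_take (group_sub_reps G_gs) _ => c cG c_new.
have c_rep := group_sub_reps G_gs cG.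
have [n_lt rep_c] := notin_take_reps c_rep c_new.
move: min_take; rewrite mem_take_reps ?cmin_rep // => min_rep.
move: cG; rewrite !(mem_group G_gs) ?rep_mem // => /andP[_ c_max].
rewrite (leq_trans rep_c c_max) andbT.
exact: leq_trans (gmin_le min_G) (ltnW min_rep).
Qed.

Lemma rep_in_passed_group n g : started n g -> n < size reps -> rep n < g ->
  rep n \in group_of pi g.
Proof.
case/andP => nt_g min_take n_lt rep_g; have [G_gs min_G] := group_ofP nt_g.
move: min_take; rewrite mem_take_reps ?cmin_rep // => min_rep.
have := cycle_in_group_interval (nontriv_cell nt_g) min_G => /andP[_ g_max].
rewrite mem_group ?rep_mem // (leq_trans (ltnW rep_g) g_max) andbT.
exact: leq_trans (gmin_le min_G) (ltnW min_rep).
Qed.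

Lemma next_group_top G n : G \in groups -> gmax G = top n ->
    (n < size reps -> top n < rep n) ->
  omap gmin (next_group pi G) = if n < size reps then Some (rep n) else None.
Proof.
move=> G_gs maxG top_rep; have := next_groupP G_gs; rewrite maxG.
case: next_group => [H [H_rep top_H H_min]|le_top] /=.
  have H_new : gmin H \notin take n reps.
    by apply/negP => /gmax_ge; have := rep_lt_cmax H_rep; lia.
  have [n_lt rep_H] := notin_take_reps H_rep H_new; rewrite n_lt; congr Some.
  by apply/eqP; rewrite eqn_leq rep_H H_min ?rep_mem ?top_rep.
case: ifP => // n_lt; have := le_top (rep n); rewrite rep_mem n_lt => /(_ isT).
by have := top_rep n_lt; lia.
Qed.

Lemma gmax_group_top n a L : 0 < n -> on_track n a L ->
  (a == gmax (group_of pi a)) = (a == top n).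
Proof.
move=> n_gt0 L_track; have [a_started below_top ahead] := L_track n_gt0.
have [nt_a _] := andP a_started; have [G_gs min_G] := group_ofP nt_a.
have a_G := cycle_in_group_interval (nontriv_cell nt_a) min_G.
have spans_a := spans_reps G_gs a_G.
apply/eqP/eqP => [aE|aE].
  apply/eqP; rewrite eqn_leq started_le_top // below_top ?mem_head //.
  by rewrite spans_a -aE ltnn.
have : ~~ spans reps a.
  by apply: (@unspanned_after_top n); rewrite ?aE // => /ahead[]; rewrite aE.
rewrite spans_a; lia.
Qed.

Lemma anext_route n s a L : route n s L -> on_track n a L ->
  anext pi a s (rev (take n reps)) =
    if starts_next n a L then Some (rep n, rev (take n.+1 reps))
    else omap (pair^~ (rev (take n reps))) (ohead L).
Proof.
move=> L_route L_track; rewrite /anext (route_hold L_route).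
have nextS : n < size reps -> rev (take n.+1 reps) = rep n :: rev (take n reps).
  by move=> n_lt; rewrite (take_nth 0 n_lt) rev_rcons.
case: L L_route L_track => [|g L] L_route L_track.
  rewrite first_unstarted_take ?rep_mem //; last first.
    by move=> c c_rep /(notin_take_reps c_rep)[].
  by rewrite /starts_next /= andbT; case: ifP => // n_lt; rewrite nextS.
have g_started := route_started L_route; have n_gt0 : 0 < n.
  by case: (n) L_route => // /route0.
have [a_started _ ahead] := L_track n_gt0; have [nt_a _] := andP a_started.
have a_rep : n < size reps -> a < rep n by case/ahead.
rewrite /= nt_a (gmax_group_top n_gt0 L_track).
rewrite (first_unstarted_group g_started) /starts_next.
have no_rep : ~~ (n < size reps) -> (rep n \in group_of pi g) = false.
  rewrite -rep_mem; apply: contraNF; apply: group_sub_reps.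
  by have /andP[/group_ofP[]] := g_started.
case: (a =P top n) => [aE|_] /=; last first.
  case: (boolP (n < size reps)) => [n_lt|/no_rep->//].
  rewrite a_rep //= nextS //; case: ifP => [_|rep_notin].
    have -> // : strictly_between a (rep n) g = (rep n < g).
    by rewrite /strictly_between; have := a_rep n_lt; lia.
  by case: ifP => // /(rep_in_passed_group g_started n_lt); rewrite rep_notin.
have [G_gs _] := group_ofP nt_a.
have maxG : gmax (group_of pi a) = top n.
  by have /eqP := gmax_group_top n_gt0 L_track; rewrite aE !eqxx => /eqP/eqP <-.
have := next_group_top G_gs maxG; rewrite -aE => /(_ a_rep).
case: next_group => [H|]; case: ifP => //= n_lt.
  by case=> ->; rewrite nextS.
by rewrite no_rep ?n_lt.
Qed.

Definition budget k n s a :=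
  pending m k s a + (gap k && ~~ has (ltn k) (take n reps)).

Lemma budget_deliver k n s a g : hold s = Some g -> cell g ->
  (a <= k < g) + budget k n (pns s g) g <= budget k n s a.
Proof.
by move=> hold_g g_cell; rewrite /budget pending_pns // /pending hold_g /=; lia.
Qed.

Lemma budget_start k n s a L :
    route n s L -> on_track n a L -> starts_next n a L ->
  (a <= k < rep n) + budget k n.+1 (pns s (rep n)) (rep n) <= budget k n s a.
Proof.
move=> L_route L_track starts; have n_lt : n < size reps by case/andP: starts.
have rep_reps : rep n \in reps by rewrite rep_mem.
rewrite /budget pending_pns ?rep_cell // /pending.
rewrite (take_nth 0 n_lt) has_rcons negb_or (route_hold L_route).
rewrite -!addnA [X in X <= _]addnCA leq_add2l /=.
have [[g [L' [-> a_rep rep_g]]]|[top_rep a_top top_goal]] :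
  (exists g L', [/\ L = g :: L', a < rep n & rep n < g]) \/
  [/\ top n < rep n, a <= k -> top n <= k
    & top n <= k -> goal_beyond k (ohead L) = false].
- case: (posnP n) => [n0|n_gt0].
    right; move: L_route; rewrite n0 => /route0->; rewrite take0; split=> //.
    by have := rep_cell rep_reps; rewrite n0 => /andP[].
  have [g [L' [LE a_rep [aE|rep_g]]]] :=
    starts_next_held L_route L_track starts n_gt0.
    right; rewrite LE -aE; split=> //= a_k; apply/negbTE; rewrite -leqNgt.
    apply: leq_trans a_k; rewrite aE; apply: started_le_top.
    by move: L_route; rewrite LE => /route_started.
  by left; exists g, L'.
- by case: has => /=; lia.
- case: (ltnP k (rep n)) => [k_rep|rep_k] /=; last first.
    by rewrite top_goal ?(leq_trans (ltnW top_rep)) //; lia.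
  case: (leqP a k) => [/a_top top_k|] /=; last by lia.
  by rewrite top_goal // hasN_take_reps // (gap_after_top n_lt) ?top_k.
Qed.

Definition remaining n s := size reps - n + misplaced s.

Definition completes n s a P :=
  [/\ within m P, size P = remaining n s,
      hold (foldl pns s P) = None,
      forall q, cell q -> cont (foldl pns s P) q = Some q
    & forall k, rcross k a P <= budget k n s a].

Lemma completes_cons n n' s a p P : cell p -> completes n' (pns s p) p P ->
    remaining n s = (remaining n' (pns s p)).+1 ->
    (forall k, (a <= k < p) + budget k n' (pns s p) p <= budget k n s a) ->
  completes n s a (p :: P).
Proof.
move=> p_cell [P_cells P_size P_hold P_cont P_cross] remE le_budget.
split=> //=; rewrite ?p_cell ?P_size // => k.
by rewrite rcross_cons (leq_trans _ (le_budget k)) // leq_add2l.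
Qed.

Lemma completes_nil n s a : size reps <= n -> route n s [::] ->
  completes n s a [::].
Proof.
move=> le_n L_route; have hold_s := route_hold L_route.
have [_ _ _ settled] := L_route.
have home q : cell q -> cont s q = Some q.
  move=> q_cell; rewrite settled // /started take_oversize //.
  case: (boolP (nontriv q)) => [/cmin_rep->//|].
  by rewrite /Defs.nontriv q_cell negbK => /eqP->.
split=> //; apply/esym/eqP; rewrite addn_eq0 subn_eq0 le_n /=.
rewrite -leqn0 leqNgt -has_count.
by apply/hasPn => q; rewrite mem_ntcells negbK => /nontriv_cell/home/eqP.
Qed.

Lemma arun_completes fuel n s a L : route n s L -> on_track n a L ->
  remaining n s < fuel ->
  completes n s a (arun pi fuel a s (rev (take n reps))).
Proof.
elim: fuel n s a L => // fuel IHfuel n s a L L_route L_track fuel_gt.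
rewrite /= (anext_route L_route L_track); case: ifP => [starts|/negbT no_start].
  have n_lt : n < size reps by case/andP: starts.
  have remE : remaining n s = (remaining n.+1 (pns s (rep n))).+1.
    by rewrite /remaining (misplaced_start L_route n_lt); lia.
  have [l L_route' l_orb] := route_start L_route n_lt.
  apply: (completes_cons _ _ remE) => [||k]; first by rewrite rep_cell ?rep_mem.
    apply: IHfuel L_route' (on_track_start L_route L_track starts l_orb) _.
    by rewrite -ltnS -remE.
  exact: budget_start L_route L_track starts.
case: L L_route L_track no_start => [|g L] L_route L_track no_start /=.
  apply: completes_nil L_route; rewrite leqNgt.
  by move: no_start; rewrite /starts_next /= andbT.
have remE : remaining n s = (remaining n (pns s g)).+1.
  by rewrite /remaining (misplaced_deliver L_route) addnS.
have g_cell := started_cell (route_started L_route).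
apply: (completes_cons g_cell _ remE) => [|k].
  have g_track := on_track_deliver L_route L_track no_start.
  by apply: IHfuel (route_deliver L_route) g_track _; rewrite -ltnS -remE.
exact: budget_deliver (route_hold L_route) g_cell.
Qed.

Lemma OptPlanLOR_completes : completes 0 (init pi) 1 (OptPlanLOR pi).
Proof.
have -> : OptPlanLOR pi = arun pi (4 * m + 1) 1 (init pi) (rev (take 0 reps)).
  by rewrite take0.
apply: arun_completes route_init _ _ => //.
have [ntcells_m reps_m] : size ntcells <= m /\ size reps <= m.
  by split; rewrite -[X in _ <= X](size_iota 1) size_filter count_size.
by rewrite /remaining misplaced_init; lia.
Qed.

Lemma OptPlanLOR_valid : valid pi (OptPlanLOR pi).
Proof. by have [] := OptPlanLOR_completes. Qed.

Lemma size_OptPlanLOR : size (OptPlanLOR pi) = size ntcells + size reps.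
Proof.
have [_ -> _ _ _] := OptPlanLOR_completes.
by rewrite /remaining misplaced_init subn0 addnC.
Qed.

Lemma rcross_OptPlanLOR k : rcross k 1 (OptPlanLOR pi) <= needed_rcross k.
Proof.
have [_ _ _ _ /(_ k)] := OptPlanLOR_completes.
by rewrite /budget take0 andbT.
Qed.

End Instance.

Theorem theorem1 (pi : seq nat) (Hpi : is_instance pi) :
  valid pi (OptPlanLOR pi) /\
  (forall P : seq nat, valid pi P -> nswaps (OptPlanLOR pi) <= nswaps P) /\
  (forall P : seq nat, valid pi P -> nswaps P = nswaps (OptPlanLOR pi) ->
     travel (OptPlanLOR pi) <= travel P).
Proof.
split; first exact: OptPlanLOR_valid.
split=> P P_valid => [|_].
  by rewrite /nswaps size_OptPlanLOR // leq_size_valid.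
apply: (@leq_travel (size pi)) => [||k k_gt0].
- by have [] := OptPlanLOR_valid Hpi.
- by have [] := P_valid.
- apply: leq_trans (rcross_OptPlanLOR Hpi k) _.
  exact: (leq_rcross_valid Hpi P_valid k_gt0).
Qed.
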